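(* Let $u:A\rightarrow B$ be a ring morphism. (i) If $u$ is a PSI-morphism, then so is the induced morphism $A/I \rightarrow B/J$ for all ideals $I$ of $A$ and $J$ of $B$ such that $u(I)\subseteq J$. (ii) If $u$ is a PSI-morphism, then so is the induced morphism $A_S \rightarrow B_T$ for all multiplicative sets $S$ of $A$ and $T$ of $B$ such that $u(S)\subseteq T$. (iii) $u$ is a PSI-morphism if and only if the induced morphism $A/P \rightarrow B/PB$ is a PSI-morphism for each $P\in \mathrm{Spec}(A)$. (iv) $u$ is a PSI-morphism if and only if the induced morphism $A_M \rightarrow B_M$ is a PSI-morphism for each $M\in \mathrm{Max}(A)$.
   Context: All rings are commutative and unitary, and ring morphisms are unitary. For a ring morphism $u:A\to B$, a proper ideal $I$ of $B$ is called $A$-prime if $u(a)b\in I$ with $a\in A$ and $b\in B$ implies that $u(a)\in I$ or $b\in I$. The morphism $u$ is a PSI-morphism if every $A$-prime ideal of $B$ is a prime ideal of $B$. For an ideal $P$ of $A$, $PB$ denotes the ideal $u(P)B$; for a maximal ideal $M$ of $A$, $B_M$ denotes the localization of $B$ at $u(A\setminus M)$, i.e. $B\otimes_A A_M$. $\mathrm{Max}(A)$ is the set of maximal ideals of $A$. *)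

(* Defs.v *)
From HB Require Import structures.
From mathcomp Require Import all_boot all_algebra.
From mathcomp Require Import ring boolp.

Set Implicit Arguments.
Unset Strict Implicit.
Unset Printing Implicit Defensive.

Import GRing.Theory.
Local Open Scope ring_scope.
Local Open Scope quotient_scope.

(* Rings are [comPzRingType]s, so that the zero ring is allowed: it arises as  *)
(* the quotient by the unit ideal and as a localization at a multiplicative    *)
(* set containing 0. The [idealr] structure of [ring_quotient] and its ring    *)
(* quotients only cover proper decidable ideals of nonzero rings.              *)

Record ideal (A : comPzRingType) := Ideal {
  in_ideal :> A -> Prop;
  ideal0 : in_ideal 0;
  idealD : forall x y, in_ideal x -> in_ideal y -> in_ideal (x + y);
  idealMl : forall a x, in_ideal x -> in_ideal (a * x)
}.

Definition is_proper (A : comPzRingType) (I : ideal A) : Prop :=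
  exists x, ~ I x.

Definition is_prime (A : comPzRingType) (P : ideal A) : Prop :=
  is_proper P /\ forall x y : A, P (x * y) -> P x \/ P y.

Definition is_maximal (A : comPzRingType) (M : ideal A) : Prop :=
  is_proper M /\
  forall J : ideal A, is_proper J ->
    (forall x, M x -> J x) -> forall x, J x -> M x.

Section PSI.
Variables (A B : comPzRingType) (u : {rmorphism A -> B}).

(* These are the A-prime ideals of B. *)
Definition is_prime_over (I : ideal B) : Prop :=
  is_proper I /\
  forall (a : A) (b : B), I (u a * b) -> I (u a) \/ I b.

Definition PSI_morphism : Prop :=
  forall I : ideal B, is_prime_over I -> is_prime I.

End PSI.

Section IdealQuotient.
Variables (A : comPzRingType) (I : ideal A).

Definition ideal_pred : {pred A} := fun x => `[< I x >].

Lemma ideal_predP x : reflect (I x) (x \in ideal_pred).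
Proof. exact: asboolP. Qed.

Lemma ideal_pred_zmod_closed : zmod_closed ideal_pred.
Proof.
split=> [|x y /ideal_predP Ix /ideal_predP Iy]; apply/ideal_predP.
  exact: ideal0.
by apply: idealD => //; rewrite -mulN1r; apply: idealMl.
Qed.

HB.instance Definition _ :=
  GRing.isZmodClosed.Build A ideal_pred ideal_pred_zmod_closed.

Definition quot_ring := @Quotient.quot A ideal_pred.

HB.instance Definition _ := GRing.Zmodule.on quot_ring.
HB.instance Definition _ :=
  EqQuotient.copy quot_ring (@Quotient.quot A ideal_pred).

Lemma quot_ringP (x y : A) : \pi_quot_ring x = \pi_quot_ring y <-> I (x - y).
Proof.
split=> [/eqP|Ixy]; last apply/eqP;
  by rewrite -[_ == _]Quotient.idealrBE; apply/ideal_predP.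
Qed.

Lemma quot_repr (x : A) : I (repr (\pi_quot_ring x) - x).
Proof. by apply/quot_ringP; rewrite reprK. Qed.

Definition quot_one : quot_ring := \pi_quot_ring 1.
Definition quot_mul := lift_op2 quot_ring *%R.

Lemma pi_quotD : {morph \pi_quot_ring : x y / x + y}.
Proof. exact: Quotient.pi_add. Qed.

Lemma pi_quotM x y :
  quot_mul (\pi_quot_ring x) (\pi_quot_ring y) = \pi_quot_ring (x * y).
Proof.
unlock quot_mul; apply/quot_ringP; set x' := repr _; set y' := repr _.
have -> : x' * y' - x * y = y' * (x' - x) + x * (y' - y).
  by rewrite !mulrBr [y' * x]mulrC [y' * x']mulrC addrA subrK.
by apply: idealD; apply: idealMl; apply: quot_repr.
Qed.

Lemma quot_mulA : associative quot_mul.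
Proof.
by elim/quotW=> x; elim/quotW=> y; elim/quotW=> z; rewrite !pi_quotM mulrA.
Qed.

Lemma quot_mulC : commutative quot_mul.
Proof. by elim/quotW=> x; elim/quotW=> y; rewrite !pi_quotM mulrC. Qed.

Lemma quot_mul1 : left_id quot_one quot_mul.
Proof. by elim/quotW=> x; rewrite pi_quotM mul1r. Qed.

Lemma quot_mulDl : left_distributive quot_mul +%R.
Proof.
elim/quotW=> x; elim/quotW=> y; elim/quotW=> z.
by rewrite -pi_quotD !pi_quotM mulrDl pi_quotD.
Qed.

HB.instance Definition _ := GRing.Zmodule_isComPzRing.Build quot_ring
  quot_mulA quot_mulC quot_mul1 quot_mulDl.

Lemma quot_pi_zmod_morphism : zmod_morphism \pi_quot_ring.
Proof.
move=> x y; apply: (addIr (\pi_quot_ring y)).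
by rewrite -pi_quotD !subrK.
Qed.

Lemma quot_pi_monoid_morphism : monoid_morphism \pi_quot_ring.
Proof. by split=> // x y; rewrite -pi_quotM. Qed.

End IdealQuotient.

Section QuotientMap.
Variables (A B : comPzRingType) (u : {rmorphism A -> B}).
Variables (I : ideal A) (J : ideal B).

Definition quot_map of (forall x, I x -> J (u x)) : quot_ring I -> quot_ring J :=
  fun x => \pi_(quot_ring J) (u (repr x)).

Hypothesis uIJ : forall x, I x -> J (u x).

Lemma quot_map_pi x :
  quot_map uIJ (\pi_(quot_ring I) x) = \pi_(quot_ring J) (u x).
Proof.
apply/quot_ringP; rewrite -rmorphB; apply: uIJ; exact: quot_repr.
Qed.

Lemma quot_map_zmod_morphism : zmod_morphism (quot_map uIJ).
Proof.
elim/quotW=> x; elim/quotW=> y.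
by rewrite -quot_pi_zmod_morphism !quot_map_pi rmorphB quot_pi_zmod_morphism.
Qed.

Lemma quot_map_monoid_morphism : monoid_morphism (quot_map uIJ).
Proof.
have [piI1 piIM] := quot_pi_monoid_morphism I.
have [piJ1 piJM] := quot_pi_monoid_morphism J.
split=> [|]; first by rewrite -piI1 quot_map_pi rmorph1.
by elim/quotW=> x; elim/quotW=> y; rewrite -piIM !quot_map_pi rmorphM piJM.
Qed.

HB.instance Definition _ := GRing.isZmodMorphism.Build _ _ (quot_map uIJ)
  quot_map_zmod_morphism.
HB.instance Definition _ := GRing.isMonoidMorphism.Build _ _ (quot_map uIJ)
  quot_map_monoid_morphism.

End QuotientMap.

Section ExtendedIdeal.
Variables (A B : comPzRingType) (u : {rmorphism A -> B}) (I : ideal A).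

Definition in_extended_ideal (y : B) : Prop :=
  exists s : seq (A * B),
    (forall p, p \in s -> I p.1) /\ y = \sum_(p <- s) u p.1 * p.2.

Lemma extended_ideal0 : in_extended_ideal 0.
Proof. by exists [::]; rewrite big_nil. Qed.

Lemma extended_idealD x y :
  in_extended_ideal x -> in_extended_ideal y -> in_extended_ideal (x + y).
Proof.
move=> [s [Is ->]] [t [It ->]]; exists (s ++ t); rewrite big_cat; split=> // p.
by rewrite mem_cat => /orP[/Is|/It].
Qed.

Lemma extended_idealMl a x : in_extended_ideal x -> in_extended_ideal (a * x).
Proof.
move=> [s [Is ->]]; exists [seq (p.1, a * p.2) | p <- s]; split.
  by move=> _ /mapP[p ps ->] /=; exact: Is ps.
by rewrite big_map mulr_sumr; apply: eq_bigr => p _; rewrite mulrCA.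
Qed.

Definition extended_ideal : ideal B :=
  Ideal extended_ideal0 extended_idealD extended_idealMl.

Lemma sub_extended_ideal x : I x -> extended_ideal (u x).
Proof.
move=> Ix; exists [:: (x, 1)]; rewrite big_seq1 mulr1; split=> // p.
by rewrite inE => /eqP->.
Qed.

End ExtendedIdeal.

Record mult_set (A : comPzRingType) := MultSet {
  in_mult_set :> A -> Prop;
  mult_set1 : in_mult_set 1;
  mult_setM : forall x y, in_mult_set x -> in_mult_set y -> in_mult_set (x * y)
}.

Section Localization.
Variables (A : comPzRingType) (S : mult_set A).

Definition mult_set_pred : {pred A} := fun s => `[< S s >].
Definition loc_pair := (A * {s : A | s \in mult_set_pred})%type.

Definition numer (x : loc_pair) : A := x.1.
Definition denom (x : loc_pair) : A := val x.2.

Lemma denomP x : S (denom x).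
Proof. by apply/asboolP; exact: (valP x.2). Qed.

Definition mk_pair (a s : A) (Ss : S s) : loc_pair :=
  (a, exist _ s (asboolT Ss)).

(* The factor [w] is needed because [S] may contain zero divisors. *)
Definition loc_equiv (x y : loc_pair) : bool :=
  `[< exists2 w, S w & w * (numer x * denom y) = w * (numer y * denom x) >].

Lemma loc_equiv_refl : reflexive loc_equiv.
Proof. by move=> x; apply/asboolP; exists 1; first exact: mult_set1. Qed.

Lemma loc_equiv_sym : symmetric loc_equiv.
Proof. by move=> x y; apply/asboolP/asboolP => -[w Sw /esym]; exists w. Qed.

Lemma loc_equiv_trans : transitive loc_equiv.
Proof.
move=> y x z /asboolP[v Sv xy] /asboolP[w Sw yz]; apply/asboolP.
exists (v * w * denom y); first by do !apply: mult_setM => //; exact: denomP.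
move: (numer x) (denom x) (numer y) (denom y) (numer z) (denom z) xy yz.
move=> a s b t c r xy yz.
transitivity (v * (a * t) * (w * r)); first by ring.
rewrite xy; transitivity (w * (b * r) * (v * s)); first by ring.
by rewrite yz; ring.
Qed.

Canonical loc_equiv_rel :=
  EquivRel loc_equiv loc_equiv_refl loc_equiv_sym loc_equiv_trans.

Definition loc_ring := {eq_quot loc_equiv}.

HB.instance Definition _ : EqQuotient _ loc_equiv loc_ring :=
  EqQuotient.on loc_ring.
HB.instance Definition _ := Choice.on loc_ring.

Definition frac (a s : A) (Ss : S s) : loc_ring := \pi_loc_ring (mk_pair a Ss).

Lemma locW (P : loc_ring -> Prop) :
  (forall a s (Ss : S s), P (frac a Ss)) -> forall x, P x.
Proof.
move=> Pfrac; elim/quotW=> -[a [s Ss]].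
have -> : Ss = asboolT (asboolW Ss) by exact: bool_irrelevance.
exact: Pfrac.
Qed.

Lemma frac_eqP a s (Ss : S s) b t (St : S t) :
  frac a Ss = frac b St <-> exists2 w, S w & w * (a * t) = w * (b * s).
Proof. by split=> [/eqmodP/asboolP|wP] //; apply/eqmodP/asboolP. Qed.

Lemma frac_repr a s (Ss : S s) (x := repr (frac a Ss)) :
  exists2 w, S w & w * (numer x * s) = w * (a * denom x).
Proof.
have: \pi_loc_ring x = \pi_loc_ring (mk_pair a Ss) by rewrite reprK.
by move/eqmodP/asboolP.
Qed.

Definition loc0 : loc_ring := frac 0 (mult_set1 S).
Definition loc1 : loc_ring := frac 1 (mult_set1 S).
Definition loc_opp : loc_ring -> loc_ring :=
  locked (fun x => frac (- numer (repr x)) (denomP (repr x))).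
Definition loc_add : loc_ring -> loc_ring -> loc_ring :=
  locked (fun x y =>
    frac (numer (repr x) * denom (repr y) + numer (repr y) * denom (repr x))
         (mult_setM (denomP (repr x)) (denomP (repr y)))).
Definition loc_mul : loc_ring -> loc_ring -> loc_ring :=
  locked (fun x y =>
    frac (numer (repr x) * numer (repr y))
         (mult_setM (denomP (repr x)) (denomP (repr y)))).

Lemma loc_oppE a s (Ss : S s) : loc_opp (frac a Ss) = frac (- a) Ss.
Proof.
unlock loc_opp; apply/frac_eqP; have [w Sw] := frac_repr a Ss.
by exists w; rewrite // !mulNr !mulrN; congr (- _).
Qed.

Lemma loc_addE a s (Ss : S s) b t (St : S t) :
  loc_add (frac a Ss) (frac b St) = frac (a * t + b * s) (mult_setM Ss St).
Proof.
unlock loc_add; apply/frac_eqP.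
have [v Sv] := frac_repr a Ss; have [w Sw] := frac_repr b St.
set x := repr (frac a Ss); set y := repr (frac b St).
move: (numer x) (denom x) (numer y) (denom y) => a' s' b' t' yE xE.
exists (v * w); first exact: mult_setM.
transitivity (v * (a' * s) * (w * t' * t) + w * (b' * t) * (v * s' * s)).
  by ring.
by rewrite xE yE; ring.
Qed.

Lemma loc_mulE a s (Ss : S s) b t (St : S t) :
  loc_mul (frac a Ss) (frac b St) = frac (a * b) (mult_setM Ss St).
Proof.
unlock loc_mul; apply/frac_eqP.
have [v Sv] := frac_repr a Ss; have [w Sw] := frac_repr b St.
set x := repr (frac a Ss); set y := repr (frac b St).
move: (numer x) (denom x) (numer y) (denom y) => a' s' b' t' yE xE.
exists (v * w); first exact: mult_setM.
transitivity (v * (a' * s) * (w * (b' * t))); first by ring.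
by rewrite xE yE; ring.
Qed.

Lemma frac_eq a s (Ss : S s) b t (St : S t) :
  a * t = b * s -> frac a Ss = frac b St.
Proof.
by move=> eq_ab; apply/frac_eqP; exists 1; rewrite ?eq_ab //; apply: mult_set1.
Qed.

Lemma loc_addA : associative loc_add.
Proof.
elim/locW=> a s Ss; elim/locW=> b t St; elim/locW=> c r Sr.
by rewrite !loc_addE; apply: frac_eq; ring.
Qed.

Lemma loc_addC : commutative loc_add.
Proof.
elim/locW=> a s Ss; elim/locW=> b t St.
by rewrite !loc_addE; apply: frac_eq; ring.
Qed.

Lemma loc_add0 : left_id loc0 loc_add.
Proof. by elim/locW=> a s Ss; rewrite loc_addE; apply: frac_eq; ring. Qed.

Lemma loc_addN : left_inverse loc0 loc_opp loc_add.
Proof.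
by elim/locW=> a s Ss; rewrite loc_oppE loc_addE; apply: frac_eq; ring.
Qed.

HB.instance Definition _ :=
  GRing.isZmodule.Build loc_ring loc_addA loc_addC loc_add0 loc_addN.

Lemma loc_mulA : associative loc_mul.
Proof.
elim/locW=> a s Ss; elim/locW=> b t St; elim/locW=> c r Sr.
by rewrite !loc_mulE; apply: frac_eq; ring.
Qed.

Lemma loc_mulC : commutative loc_mul.
Proof.
elim/locW=> a s Ss; elim/locW=> b t St.
by rewrite !loc_mulE; apply: frac_eq; ring.
Qed.

Lemma loc_mul1 : left_id loc1 loc_mul.
Proof. by elim/locW=> a s Ss; rewrite loc_mulE; apply: frac_eq; ring. Qed.

Lemma loc_mulDl : left_distributive loc_mul loc_add.
Proof.
elim/locW=> a s Ss; elim/locW=> b t St; elim/locW=> c r Sr.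
by rewrite !(loc_addE, loc_mulE); apply: frac_eq; ring.
Qed.

HB.instance Definition _ := GRing.Zmodule_isComPzRing.Build loc_ring
  loc_mulA loc_mulC loc_mul1 loc_mulDl.

Lemma fracN a s (Ss : S s) : - frac a Ss = frac (- a) Ss.
Proof. exact: loc_oppE. Qed.

Lemma fracD a s (Ss : S s) b t (St : S t) :
  frac a Ss + frac b St = frac (a * t + b * s) (mult_setM Ss St).
Proof. exact: loc_addE. Qed.

Lemma fracM a s (Ss : S s) b t (St : S t) :
  frac a Ss * frac b St = frac (a * b) (mult_setM Ss St).
Proof. exact: loc_mulE. Qed.

Lemma frac1 : frac 1 (mult_set1 S) = 1.
Proof. by []. Qed.

End Localization.

Section LocalizationMap.
Variables (A B : comPzRingType) (u : {rmorphism A -> B}).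
Variables (S : mult_set A) (T : mult_set B).

Definition loc_map (uST : forall s, S s -> T (u s)) : loc_ring S -> loc_ring T :=
  fun x => frac (u (numer (repr x))) (uST _ (denomP (repr x))).

Hypothesis uST : forall s, S s -> T (u s).

Lemma loc_map_frac a s (Ss : S s) :
  loc_map uST (frac a Ss) = frac (u a) (uST Ss).
Proof.
apply/frac_eqP; have [w Sw wE] := frac_repr a Ss.
by exists (u w); [exact: uST | rewrite -!rmorphM wE].
Qed.

Lemma loc_map_zmod_morphism : zmod_morphism (loc_map uST).
Proof.
elim/locW=> a s Ss; elim/locW=> b t St.
rewrite fracN fracD !loc_map_frac fracN fracD.
by apply: frac_eq; rewrite !rmorphD !rmorphM rmorphN.
Qed.

Lemma loc_map_monoid_morphism : monoid_morphism (loc_map uST).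
Proof.
split=> [|].
  by rewrite -!frac1 loc_map_frac; apply: frac_eq; rewrite !rmorph1.
elim/locW=> a s Ss; elim/locW=> b t St.
rewrite fracM !loc_map_frac fracM.
by apply: frac_eq; rewrite !rmorphM.
Qed.

HB.instance Definition _ := GRing.isZmodMorphism.Build _ _ (loc_map uST)
  loc_map_zmod_morphism.
HB.instance Definition _ := GRing.isMonoidMorphism.Build _ _ (loc_map uST)
  loc_map_monoid_morphism.

End LocalizationMap.

Section ImageMultSet.
Variables (A B : comPzRingType) (u : {rmorphism A -> B}) (S : mult_set A).

Definition in_image_mult_set (t : B) : Prop := exists2 s, S s & t = u s.

Lemma image_mult_set1 : in_image_mult_set 1.
Proof. by exists 1; [exact: mult_set1 | rewrite rmorph1]. Qed.

Lemma image_mult_setM x y :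
  in_image_mult_set x -> in_image_mult_set y -> in_image_mult_set (x * y).
Proof.
move=> [s Ss ->] [t St ->]; exists (s * t); first exact: mult_setM.
by rewrite rmorphM.
Qed.

Definition image_mult_set : mult_set B :=
  MultSet image_mult_set1 image_mult_setM.

Lemma sub_image_mult_set s : S s -> image_mult_set (u s).
Proof. by exists s. Qed.

End ImageMultSet.

Section PrimeComplement.
Variables (A : comPzRingType) (P : ideal A) (primeP : is_prime P).

Lemma prime_compl1 : ~ P 1.
Proof.
case: primeP => -[x notPx] _ P1; apply: notPx; rewrite -[x]mulr1.
exact: idealMl.
Qed.

Lemma prime_complM x y : ~ P x -> ~ P y -> ~ P (x * y).
Proof. by move=> notPx notPy /(proj2 primeP)[]. Qed.

Definition prime_compl : mult_set A := MultSet prime_compl1 prime_complM.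

End PrimeComplement.

Lemma maximal_is_prime (A : comPzRingType) (M : ideal A) :
  is_maximal M -> is_prime M.
Proof.
move=> [properM maxM]; split=> // x y Mxy.
case: (EM (M x)) => [|notMx]; [by left | right].
pose J z := exists m a, M m /\ z = m + a * x.
have J0 : J 0.
  by exists 0, 0; split; [exact: ideal0 | rewrite mul0r addr0].
have JD z t : J z -> J t -> J (z + t).
  move=> [m [a [Mm ->]]] [n [b [Mn ->]]]; exists (m + n), (a + b).
  by split; [exact: idealD | ring].
have JMl c z : J z -> J (c * z).
  move=> [m [a [Mm ->]]]; exists (c * m), (c * a).
  by split; [exact: idealMl | ring].
have Jx : J x by exists 0, 1; split; [exact: ideal0 | rewrite mul1r add0r].
have MJ z : M z -> J z by exists z, 0; split; rewrite // mul0r addr0.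
have [m [a [Mm one_eq]]] : J 1.
  apply: contrapT => notJ1; apply: notMx.
  by apply: (maxM (Ideal J0 JD JMl)) => //; exists 1.
rewrite -[y]mul1r one_eq mulrDl mulrC -mulrA.
by apply: idealD; apply: idealMl.
Qed.

(* Main.v *)
From HB Require Import structures.
From mathcomp Require Import all_boot all_algebra.
From mathcomp Require Import boolp classical_sets.
Require Import Defs.

Set Implicit Arguments.
Unset Strict Implicit.
Unset Printing Implicit Defensive.

Import GRing.Theory.
Local Open Scope ring_scope.
Local Open Scope quotient_scope.

(** All four assertions compare [u : A -> B] with another morphism
    [u' : A' -> B'] through a commutative square

        A --u--> B
        |f       |g
        A' -u'-> B'

    whose vertical maps are quotient projections or localization maps. Both
    kinds of map hit every element of their target up to associates: a fraction
    [b / s] generates the same ideal as [b / 1]. An ideal does not distinguish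
    associates, so every instance of the primality condition over [u'] for an
    ideal [K] of [B'] can be rewritten with elements coming from [A] and [B]:
    [K] is prime over [u'] if and only if its preimage under [g] is prime over
    [u] ([prime_over_preimage]). Since prime means prime over the identity, the
    same equivalence for the square on [g] and [g] says that [K] is prime if
    and only if its preimage is.

    Therefore the PSI property passes from [u] to [u'] ([PSI_of_square]), in
    particular to all induced morphisms of quotients and of localizations.
    Conversely, an ideal [I] of [B] that is prime over [u] is prime as soon as
    it is the preimage of some ideal of [B'] and [u'] is PSI
    ([prime_of_square]). Now the preimage [P] of [I] in [A] is a prime ideal.
    On the one hand [I] contains [P B], hence is the preimage of an ideal of
    [B / P B]. On the other hand, if [M] is a maximal ideal containing [P] and
    [s] lies outside [M], then [u s] is not in [I], so [u s * b] in [I] forces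
    [b] in [I]; hence [I] is the preimage of an ideal of the localization
    [B_M]. So it is enough to know that the morphisms [A / P -> B / P B], or
    the morphisms [A_M -> B_M], are PSI. *)

(** * Preimages of ideals and primality *)

Section Preimage.
Variables (A B : comPzRingType) (g : {rmorphism A -> B}) (K : ideal B).

Definition in_preimage (x : A) : Prop := K (g x).

Lemma in_preimage0 : in_preimage 0.
Proof. by rewrite /in_preimage rmorph0; apply: ideal0. Qed.

Lemma in_preimageD x y :
  in_preimage x -> in_preimage y -> in_preimage (x + y).
Proof. by rewrite /in_preimage rmorphD; apply: idealD. Qed.

Lemma in_preimageMl a x : in_preimage x -> in_preimage (a * x).
Proof. by rewrite /in_preimage rmorphM; apply: idealMl. Qed.

Definition preimage_ideal : ideal A :=
  Ideal in_preimage0 in_preimageD in_preimageMl.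

End Preimage.

Lemma is_properE (A : comPzRingType) (I : ideal A) : is_proper I <-> ~ I 1.
Proof.
split=> [[x notIx] I1|]; last by exists 1.
by apply: notIx; rewrite -[x]mulr1; apply: idealMl.
Qed.

Lemma is_prime_over_ext (A B : comPzRingType) (u : {rmorphism A -> B})
    (I J : ideal B) :
  (forall x, I x <-> J x) -> is_prime_over u I -> is_prime_over u J.
Proof.
move=> IJ [[x notIx] Iprime]; split; first by exists x => /IJ.
by move=> a b /IJ/Iprime[/IJ|/IJ]; [left | right].
Qed.

Lemma prime_preimage (A B : comPzRingType) (u : {rmorphism A -> B})
    (I : ideal B) :
  is_prime_over u I -> is_prime (preimage_ideal u I).
Proof.
move=> [/is_properE notI1 Iprime]; split.
  by apply/is_properE; rewrite /= /in_preimage rmorph1.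
by move=> x y; rewrite /= /in_preimage rmorphM; apply: Iprime.
Qed.

(** * Commutative squares of morphisms that are onto up to associates *)

Definition associates (A : comPzRingType) (x y : A) : Prop :=
  (exists c, x = c * y) /\ (exists d, y = d * x).

Definition onto_up_to_associates (A B : comPzRingType) (g : A -> B) : Prop :=
  forall y, exists x, associates y (g x).

Lemma ideal_associates (A : comPzRingType) (I : ideal A) x y :
  associates x y -> I x <-> I y.
Proof.
by move=> [[c xE] [d yE]]; split=> [Ix|Iy]; [rewrite yE | rewrite xE];
  apply: idealMl.
Qed.

Lemma associates_refl (A : comPzRingType) (x : A) : associates x x.
Proof. by split; exists 1; rewrite mul1r. Qed.

Lemma associatesM (A : comPzRingType) (x x' y y' : A) :
  associates x x' -> associates y y' -> associates (x * y) (x' * y').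
Proof.
move=> [[c xE] [d x'E]] [[e yE] [k y'E]]; split.
  by exists (c * e); rewrite xE yE mulrACA.
by exists (d * k); rewrite x'E y'E mulrACA.
Qed.

Lemma rmorph_associates (A B : comPzRingType) (g : {rmorphism A -> B}) x y :
  associates x y -> associates (g x) (g y).
Proof.
move=> [[c xE] [d yE]]; split.
  by exists (g c); rewrite xE rmorphM.
by exists (g d); rewrite yE rmorphM.
Qed.

Section Square.
Variables (A B A' B' : comPzRingType).
Variables (u : {rmorphism A -> B}) (u' : {rmorphism A' -> B'}).
Variables (f : {rmorphism A -> A'}) (g : {rmorphism B -> B'}).
Hypothesis square : forall a, u' (f a) = g (u a).
Hypothesis f_onto : onto_up_to_associates f.
Hypothesis g_onto : onto_up_to_associates g.

(** Ideals cannot tell associates apart, so the defining condition over [u']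
    need only be tested on elements [f a] and [g b]; there it is the condition
    over [u] for the preimage. *)
Lemma prime_over_preimage (K : ideal B') :
  is_prime_over u' K <-> is_prime_over u (preimage_ideal g K).
Proof.
have proper : is_proper K <-> is_proper (preimage_ideal g K).
  by rewrite !is_properE /= /in_preimage rmorph1.
split=> -[/proper Kproper Kprime]; split=> //.
  move=> a b; rewrite /= /in_preimage rmorphM -square; exact: Kprime.
move=> a' b' Ka'b'; have [a a'a] := f_onto a'; have [b b'b] := g_onto b'.
have {}a'a : associates (u' a') (g (u a)).
  by rewrite -square; apply: rmorph_associates.
have /Kprime : preimage_ideal g K (u a * b).
  rewrite /= /in_preimage rmorphM.
  exact/(ideal_associates K (associatesM a'a b'b)).
by case=> Kab; [left | right];
  [apply/(ideal_associates K a'a) | apply/(ideal_associates K b'b)].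
Qed.

End Square.

(** Primality is primality over the identity, and the square with rows
    [idfun], columns [g] commutes. *)
Lemma is_prime_preimage (B B' : comPzRingType) (g : {rmorphism B -> B'})
    (K : ideal B') :
  onto_up_to_associates g -> is_prime K <-> is_prime (preimage_ideal g K).
Proof.
move=> g_onto.
exact: (@prime_over_preimage _ _ _ _ idfun idfun g g
          (fun=> erefl) g_onto g_onto K).
Qed.

Section SquarePSI.
Variables (A B A' B' : comPzRingType).
Variables (u : {rmorphism A -> B}) (u' : {rmorphism A' -> B'}).
Variables (f : {rmorphism A -> A'}) (g : {rmorphism B -> B'}).
Hypothesis square : forall a, u' (f a) = g (u a).
Hypothesis f_onto : onto_up_to_associates f.
Hypothesis g_onto : onto_up_to_associates g.

Lemma PSI_of_square : PSI_morphism u -> PSI_morphism u'.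
Proof.
move=> uPSI K /(prime_over_preimage square f_onto g_onto)/uPSI Kprime.
exact/(is_prime_preimage K g_onto).
Qed.

(** The converse transfer: [I] and [K] satisfy equivalent primality conditions,
    both over [u] and [u'] and over the identities. *)
Lemma prime_of_square (I : ideal B) (K : ideal B') :
    (forall b, K (g b) <-> I b) ->
  PSI_morphism u' -> is_prime_over u I -> is_prime I.
Proof.
move=> KI u'PSI Iprime.
have /(is_prime_over_ext (u := idfun)) : forall b, preimage_ideal g K b <-> I b.
  exact: KI.
apply; apply/(is_prime_preimage K g_onto)/u'PSI.
apply/(prime_over_preimage square f_onto g_onto).
by apply: is_prime_over_ext Iprime => b; split=> /KI.
Qed.

End SquarePSI.

(** * Quotient projections *)

Section QuotientProjection.
Variables (A : comPzRingType) (I : ideal A).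

Definition quot_proj : A -> quot_ring I := \pi_(quot_ring I).

HB.instance Definition _ := GRing.isZmodMorphism.Build _ _ quot_proj
  (quot_pi_zmod_morphism I).
HB.instance Definition _ := GRing.isMonoidMorphism.Build _ _ quot_proj
  (quot_pi_monoid_morphism I).

Lemma quot_proj_onto : onto_up_to_associates quot_proj.
Proof. by elim/quotW=> x; exists x; apply: associates_refl. Qed.

Variables (J : ideal A) (sIJ : forall x, I x -> J x).

Definition in_quot_ideal (y : quot_ring I) : Prop := J (repr y).

(** Membership does not depend on the chosen representative, because two
    representatives differ by an element of [I] and [J] contains [I]. *)
Lemma in_quot_idealE x : in_quot_ideal (quot_proj x) <-> J x.
Proof.
have JIx := sIJ (quot_repr I x); rewrite /in_quot_ideal; split=> Jx.
  rewrite -[x](subKr (repr (quot_proj x))) -[- (_ - _)]mulN1r.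
  by apply: idealD => //; apply: idealMl.
by rewrite -[repr _](subrK x); apply: idealD.
Qed.

Lemma in_quot_ideal0 : in_quot_ideal 0.
Proof. by rewrite -(rmorph0 quot_proj) in_quot_idealE; apply: ideal0. Qed.

Lemma in_quot_idealD x y :
  in_quot_ideal x -> in_quot_ideal y -> in_quot_ideal (x + y).
Proof.
elim/quotW: x => x; elim/quotW: y => y.
by rewrite -(rmorphD quot_proj) !in_quot_idealE; apply: idealD.
Qed.

Lemma in_quot_idealMl a x : in_quot_ideal x -> in_quot_ideal (a * x).
Proof.
elim/quotW: x => x; elim/quotW: a => a.
by rewrite -(rmorphM quot_proj) !in_quot_idealE; apply: idealMl.
Qed.

Definition quot_ideal : ideal (quot_ring I) :=
  Ideal in_quot_ideal0 in_quot_idealD in_quot_idealMl.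

End QuotientProjection.

(** * Localization maps *)

Section LocalizationProjection.
Variables (A : comPzRingType) (S : mult_set A).

Definition loc_proj (a : A) : loc_ring S := frac a (mult_set1 S).

Lemma loc_proj_zmod_morphism : zmod_morphism loc_proj.
Proof.
by move=> x y; rewrite /loc_proj fracN fracD; apply: frac_eq; rewrite !mulr1.
Qed.

Lemma loc_proj_monoid_morphism : monoid_morphism loc_proj.
Proof.
split=> [|x y]; first exact: frac1.
by rewrite /loc_proj fracM; apply: frac_eq; rewrite !mulr1.
Qed.

HB.instance Definition _ := GRing.isZmodMorphism.Build _ _ loc_proj
  loc_proj_zmod_morphism.
HB.instance Definition _ := GRing.isMonoidMorphism.Build _ _ loc_proj
  loc_proj_monoid_morphism.

Lemma loc_proj_onto : onto_up_to_associates loc_proj.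
Proof.
elim/locW=> a s Ss; exists a; split.
  by exists (frac 1 Ss); rewrite fracM; apply: frac_eq; rewrite mulr1 mul1r.
by exists (loc_proj s); rewrite fracM; apply: frac_eq; rewrite mul1r mulr1 mulrC.
Qed.

Variable J : ideal A.
Hypothesis J_saturated : forall s x, S s -> J (s * x) -> J x.

Definition in_loc_ideal (y : loc_ring S) : Prop := J (numer (repr y)).

(** The numerator of a fraction is determined only up to cross multiplication
    by elements of [S]; saturation makes membership independent of it. *)
Lemma in_loc_idealE a s (Ss : S s) : in_loc_ideal (frac a Ss) <-> J a.
Proof.
have [w Sw] := frac_repr a Ss; rewrite /in_loc_ideal.
have := denomP (repr (frac a Ss)).
move: (numer _) (denom _) => b t St bsat.
split=> [Jb|Ja].
  apply: (J_saturated (mult_setM Sw St)).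
  by rewrite -mulrA [t * a]mulrC -bsat [b * s]mulrC; do 2!apply: idealMl.
apply: (J_saturated (mult_setM Sw Ss)).
by rewrite -mulrA [s * b]mulrC bsat [a * t]mulrC; do 2!apply: idealMl.
Qed.

Lemma in_loc_ideal0 : in_loc_ideal 0.
Proof. by rewrite -(rmorph0 loc_proj) in_loc_idealE; apply: ideal0. Qed.

Lemma in_loc_idealD x y :
  in_loc_ideal x -> in_loc_ideal y -> in_loc_ideal (x + y).
Proof.
elim/locW: x => a s Ss; elim/locW: y => b t St.
rewrite fracD !in_loc_idealE => Ja Jb.
by apply: idealD; rewrite mulrC; apply: idealMl.
Qed.

Lemma in_loc_idealMl c x : in_loc_ideal x -> in_loc_ideal (c * x).
Proof.
elim/locW: x => a s Ss; elim/locW: c => b t St.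
by rewrite fracM !in_loc_idealE; apply: idealMl.
Qed.

Definition loc_ideal : ideal (loc_ring S) :=
  Ideal in_loc_ideal0 in_loc_idealD in_loc_idealMl.

End LocalizationProjection.

(** * Existence of maximal ideals *)

(** Zorn's lemma for the ideals containing [I] and avoiding [1]. The upper bound
    of a chain is the union of the chain and [I]; adding [I], the least of these
    ideals, keeps the union nonempty when the chain is empty. *)
Lemma exists_maximal_ideal (A : comPzRingType) (I : ideal A) :
  is_proper I -> exists2 M : ideal A, is_maximal M & forall x, I x -> M x.
Proof.
move=> /is_properE notI1.
pose T := {J : ideal A | ~ J 1 /\ forall x, I x -> J x}.
pose le (J K : T) := forall x, sval J x -> sval K x.
pose I0 : T := exist _ I (conj notI1 (fun _ => id)).
have leP J K : reflect (le J K) `[< le J K >] by exact: asboolP.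
have [|J K L /leP JK /leP KL|C Ctotal|M Mmax] :=
  ZL_preorder I0 (R := fun J K => `[< le J K >]).
- by move=> J; apply/leP.
- by apply/leP => x /JK/KL.
- pose C' J := J = I0 \/ C J.
  have C'total J K : C' J -> C' K -> le J K \/ le K J.
    case=> [->|CJ]; first by left=> x; apply: (proj2 (svalP K)).
    case=> [->|CK]; first by right=> x; apply: (proj2 (svalP J)).
    by have [/leP|/leP] := Ctotal J K CJ CK; [left | right].
  pose U x := exists2 J, C' J & sval J x.
  have U0 : U 0 by exists I0; [left | apply: ideal0].
  have UD x y : U x -> U y -> U (x + y).
    move=> [J C'J Jx] [K C'K Ky]; have [JK|KJ] := C'total J K C'J C'K.
      by exists K => //; apply: idealD => //; apply: JK.
    by exists J => //; apply: idealD => //; apply: KJ.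
  have UMl a x : U x -> U (a * x).
    by move=> [J C'J Jx]; exists J => //; apply: idealMl.
  have notU1 : ~ U 1 by move=> [J _]; apply: (proj1 (svalP J)).
  have IU x : I x -> U x by move=> Ix; exists I0; first left.
  exists (exist _ (Ideal U0 UD UMl) (conj notU1 IU)) => J CJ; apply/leP => x Jx.
  by exists J; first right.
have [notM1 IM] := svalP M; exists (sval M) => //; split.
  exact/is_properE.
move=> J /is_properE notJ1 MJ.
pose J' : T := exist _ J (conj notJ1 (fun x Ix => MJ x (IM x Ix))).
by apply/(leP J' M)/Mmax/leP.
Qed.

(** * Stability of the PSI property *)

Section Stability.
Variables (A B : comPzRingType) (u : {rmorphism A -> B}).

Lemma PSI_quot_map (I : ideal A) (J : ideal B)
    (uIJ : forall x, I x -> J (u x)) :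
  PSI_morphism u -> PSI_morphism (quot_map uIJ).
Proof.
exact: (@PSI_of_square _ _ _ _ u (quot_map uIJ)
  (@quot_proj A I) (@quot_proj B J) (quot_map_pi uIJ)
  (@quot_proj_onto A I) (@quot_proj_onto B J)).
Qed.

Lemma loc_map_proj (S : mult_set A) (T : mult_set B)
    (uST : forall s, S s -> T (u s)) a :
  loc_map uST (loc_proj S a) = loc_proj T (u a).
Proof. by rewrite /loc_proj loc_map_frac; apply: frac_eq; rewrite rmorph1. Qed.

Lemma PSI_loc_map (S : mult_set A) (T : mult_set B)
    (uST : forall s, S s -> T (u s)) :
  PSI_morphism u -> PSI_morphism (loc_map uST).
Proof.
exact: (@PSI_of_square _ _ _ _ u (loc_map uST)
  (@loc_proj A S) (@loc_proj B T) (loc_map_proj uST)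
  (@loc_proj_onto A S) (@loc_proj_onto B T)).
Qed.

Lemma extended_preimage_sub (I : ideal B) y :
  extended_ideal u (preimage_ideal u I) y -> I y.
Proof.
move=> [s [Is ->]]; elim: s Is => [|p s IHs] Is.
  by rewrite big_nil; apply: ideal0.
rewrite big_cons; apply: idealD.
  by rewrite mulrC; apply: idealMl; apply: Is; rewrite mem_head.
by apply: IHs => q qs; apply: Is; rewrite inE qs orbT.
Qed.

(** The preimage [P] of [I] is a prime ideal of [A] with [P B] inside [I], so [I]
    descends to [B / P B], where the hypothesis for [P] applies. *)
Lemma PSI_from_quotients :
    (forall P : ideal A, is_prime P ->
       PSI_morphism (quot_map (@sub_extended_ideal A B u P))) ->
  PSI_morphism u.
Proof.
move=> quotPSI I Iprime; have Pprime := prime_preimage Iprime.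
set P := preimage_ideal u I.
apply: (@prime_of_square _ _ _ _ u (quot_map (@sub_extended_ideal A B u P))
  (@quot_proj A P) (@quot_proj B _) (quot_map_pi _)
  (@quot_proj_onto A P) (@quot_proj_onto B _) I
  (quot_ideal (@extended_preimage_sub I))) Iprime.
  exact: (in_quot_idealE (@extended_preimage_sub I)).
exact: quotPSI Pprime.
Qed.

(** A maximal ideal [M] above the preimage of [I] makes the image of its
    complement disjoint from [I]; primality over [u] then says that [I] is
    saturated for that image, so [I] is recovered from its extension to
    [B_M]. *)
Lemma PSI_from_localizations :
    (forall (M : ideal A) (maxM : is_maximal M),
       PSI_morphism (loc_map
         (@sub_image_mult_set A B u (prime_compl (maximal_is_prime maxM))))) ->
  PSI_morphism u.
Proof.
move=> locPSI I Iprime.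
have [M maxM PM] := exists_maximal_ideal (proj1 (prime_preimage Iprime)).
set S := prime_compl (maximal_is_prime maxM).
have Isat t b : image_mult_set u S t -> I (t * b) -> I b.
  by move=> [s notMs ->] /(proj2 Iprime)[/PM/notMs|].
apply: (@prime_of_square _ _ _ _ u (loc_map (@sub_image_mult_set A B u S))
  (@loc_proj A S) (@loc_proj B _) (loc_map_proj _)
  (@loc_proj_onto A S) (@loc_proj_onto B _) I (loc_ideal Isat)) Iprime.
  by move=> b; apply: in_loc_idealE.
exact: locPSI.
Qed.

End Stability.

Theorem corollary2p11 (A B : comPzRingType) (u : {rmorphism A -> B}) :
  [/\ PSI_morphism u ->
        forall (I : ideal A) (J : ideal B) (uIJ : forall x, I x -> J (u x)),
          PSI_morphism (quot_map uIJ),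
      PSI_morphism u ->
        forall (S : mult_set A) (T : mult_set B)
               (uST : forall s, S s -> T (u s)),
          PSI_morphism (loc_map uST),
      PSI_morphism u <->
        forall P : ideal A, is_prime P ->
          PSI_morphism (quot_map (@sub_extended_ideal A B u P))
    & PSI_morphism u <->
        forall (M : ideal A) (maxM : is_maximal M),
          PSI_morphism (loc_map
            (@sub_image_mult_set A B u (prime_compl (maximal_is_prime maxM))))].
Proof.
split.
- by move=> uPSI I J uIJ; apply: PSI_quot_map.
- by move=> uPSI S T uST; apply: PSI_loc_map.
- by split=> [uPSI P _|]; [apply: PSI_quot_map | apply: PSI_from_quotients].
- by split=> [uPSI M maxM|];
    [apply: PSI_loc_map | apply: PSI_from_localizations].
Qed.
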